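(* Let $V_{\mathbb{R}}$ be a real Banach space with complexification $V_{\mathbb{C}}=V_{\mathbb{R}}\oplus iV_{\mathbb{R}}$, let $\mathcal{C}_{\mathbb{R}}\subset V_{\mathbb{R}}$ be a closed proper convex cone containing at least two linearly independent vectors, let $\mathcal{C}_{\mathbb{C}}\subset V_{\mathbb{C}}$ be its canonical complexification and $\mathcal{C}=\mathcal{C}_{\mathbb{C}}\setminus\{0\}$. Let $P:V_{\mathbb{R}}\to V_{\mathbb{R}}$ be a real linear operator mapping $\mathcal{C}_{\mathbb{R}}\setminus\{0\}$ into itself (extended complex-linearly to $V_{\mathbb{C}}$) and let $A:V_{\mathbb{C}}\to V_{\mathbb{C}}$ be a complex linear operator. Assume that the diameter $\Delta_P$ of $P(\mathcal{C}_{\mathbb{R}}\setminus\{0\})$ with respect to the Hilbert metric of $\mathcal{C}_{\mathbb{R}}$ is finite, and that there exists $\epsilon>0$ such that for all $m\in\mathcal{C}_{\mathbb{R}}'$ and all $u\in\mathcal{C}_{\mathbb{R}}$, $$|\langle m,Au\rangle-\langle m,Pu\rangle|\le\epsilon\,\langle m,Pu\rangle.$$ If $2\epsilon(1+\cosh(\Delta_P/2))<1$, then $A\mathcal{C}\subset\mathcal{C}$ and $$\sup_{x\in\mathcal{C}}\delta_{\mathcal{C}}(Ax,Px)\le3\log\frac1{1-2\epsilon(1+\cosh(\Delta_P/2))}.$$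
   Context: A real convex cone $\mathcal{C}_{\mathbb{R}}$ (closed under addition and multiplication by nonnegative reals) is proper if $\mathcal{C}_{\mathbb{R}}\cap(-\mathcal{C}_{\mathbb{R}})=\{0\}$. Its dual cone $\mathcal{C}_{\mathbb{R}}'$ is the set of continuous real linear functionals on $V_{\mathbb{R}}$ that are $\ge0$ on $\mathcal{C}_{\mathbb{R}}$; such functionals are extended complex-linearly to $V_{\mathbb{C}}$. The canonical complexification is $$\mathcal{C}_{\mathbb{C}}=\{x\in V_{\mathbb{C}}:\ \Re(\langle l_1,x\rangle\overline{\langle l_2,x\rangle})\ge0\ \ \forall l_1,l_2\in\mathcal{C}_{\mathbb{R}}'\}$$ (equivalently $\mathcal{C}_{\mathbb{C}}=\mathbb{C}^*(\mathcal{C}_{\mathbb{R}}+i\mathcal{C}_{\mathbb{R}})$). Hilbert metric: for $x,y\in\mathcal{C}_{\mathbb{R}}\setminus\{0\}$, $h_{\mathcal{C}_{\mathbb{R}}}(x,y)=\log(\beta/\alpha)\in[0,\infty]$ with $\beta=\inf\{t>0:tx-y\in\mathcal{C}_{\mathbb{R}}\}$ and $\alpha=\sup\{t\ge0:y-tx\in\mathcal{C}_{\mathbb{R}}\}$ ($\inf\emptyset=\infty$; the value is $\infty$ if $\beta=\infty$ or $\alpha=0$). Projective metric: for $x,y\in\mathcal{C}$, let $E_{\mathcal{C}}(x,y)=\{z\in\mathbb{C}:zx-y\notin\mathcal{C}\}$ and $\delta_{\mathcal{C}}(x,y)=\log(b/a)\in[0,\infty]$, where $b$ and $a$ are the supremum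 and infimum of $|z|$ over $z\in E_{\mathcal{C}}(x,y)$ (value $\infty$ if $b=\infty$ or $a=0$). *)

(* Defs.v *)
From HB Require Import structures.
From mathcomp Require Import all_boot all_order all_algebra.
From mathcomp Require Import all_classical all_reals all_analysis.
From mathcomp Require Import complex.
Set Implicit Arguments.
Unset Strict Implicit.
Unset Printing Implicit Defensive.
Import Order.TTheory GRing.Theory Num.Theory.
Import numFieldNormedType.Exports.
Import ComplexField.Normc.
Local Open Scope classical_set_scope.
Local Open Scope complex_scope.
Local Open Scope ring_scope.

(* V (+) iV, the pair (u, v) standing for u + iv. *)
Definition complexification (V : Type) : Type := (V * V)%type.

HB.instance Definition _ (V : zmodType) :=
  GRing.Zmodule.copy (complexification V) (V * V)%type.

Section ComplexScale.
Variables (R : rcfType) (V : lmodType R).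

Definition cscale (z : R[i]) (x : complexification V) : complexification V :=
  (complex.Re z *: x.1 - complex.Im z *: x.2,
   complex.Im z *: x.1 + complex.Re z *: x.2).

Lemma cscaleA a b x : cscale a (cscale b x) = cscale (a * b) x.
Proof.
case: a b x => [a a'] [b b'] [u v]; rewrite /cscale /=; congr (_, _).
  by rewrite /= scalerBr scalerDr !scalerA scalerBl scalerDl !opprD addrACA.
rewrite /= scalerBr scalerDr !scalerA scalerBl scalerDl addrACA.
by congr (_ + _); apply: addrC.
Qed.

Lemma cscale1 : left_id 1 cscale.
Proof. by move=> [u v]; rewrite /cscale /= !scale1r !scale0r subr0 add0r. Qed.

Lemma cscaleDr : right_distributive cscale +%R.
Proof.
move=> [a b] [u v] [u' v']; rewrite /cscale /=; congr (_, _).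
  by rewrite /= !scalerDr opprD addrACA.
by rewrite /= !scalerDr addrACA.
Qed.

Lemma cscaleDl x : {morph cscale^~ x : a b / a + b}.
Proof.
move=> [a b] [a' b']; case: x => u v; rewrite /cscale /=; congr (_, _).
  by rewrite /= !scalerDl opprD addrACA.
by rewrite /= !scalerDl addrACA.
Qed.

HB.instance Definition _ := GRing.Zmodule_isLmodule.Build R[i]
  (complexification V) cscaleA cscale1 cscaleDr cscaleDl.

End ComplexScale.

Definition of_real (V : zmodType) (u : V) : complexification V := (u, 0).

(* Complex-linear extensions of a real operator and of a real functional. *)
Definition complexify_map (V W : Type) (f : V -> W) (x : complexification V) :
  complexification W := (f x.1, f x.2).

Definition pairing (R : rcfType) (V : Type) (l : V -> R)
  (x : complexification V) : R[i] := l x.1 +i* l x.2.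

Section ComplexExtensions.
Variables (R : rcfType) (V W : lmodType R).

Lemma complexify_map_is_linear (f : {linear V -> W}) :
  linear (complexify_map f : complexification V -> complexification W).
Proof.
move=> [a b] [u v] [u' v']; rewrite /complexify_map /=; congr (_, _).
  by rewrite /= linearD linearB !linearZ.
by rewrite /= linearD linearD !linearZ.
Qed.

Lemma pairing_is_linear (l : {linear V -> R^o}) (a : R[i])
    (x y : complexification V) :
  pairing l (a *: x + y) = a * pairing l x + pairing l y.
Proof.
case: a x y => [a b] [u v] [u' v']; rewrite /pairing /=.
by congr (_ +i* _); rewrite linearD ?linearB ?linearD !linearZ //= addrC
  [in RHS]addrC; congr (_ + _); rewrite addrC.
Qed.

End ComplexExtensions.

Section Cones.
Variables (R : realType) (V : normedModType R).
Implicit Types C : set V.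

Definition convex_cone C :=
  (forall x y, C x -> C y -> C (x + y)) /\
  (forall t x, 0 <= t -> C x -> C (t *: x)).

Definition proper_cone C := C `&` (-%R @` C) = [set 0].

Definition lin_indep2 (x y : V) :=
  forall a b : R, a *: x + b *: y = 0 -> a = 0 /\ b = 0.

Definition dual_cone C : set {linear V -> R^o} :=
  [set l : {linear V -> R^o} | continuous l /\ forall x, C x -> 0 <= l x].

Definition canonical_complexification C : set (complexification V) :=
  [set x | forall l1 l2 : {linear V -> R^o}, dual_cone C l1 -> dual_cone C l2 ->
    0 <= complex.Re (pairing l1 x * (pairing l2 x)^*%C)].

End Cones.

Section Metrics.
Variable R : realType.
Local Open Scope ereal_scope.

(* log (b / a) in [0, +oo]. The cases a = +oo and b = -oo are junk: they do
   not occur for nonzero vectors of a closed proper cone (hilbert_metric), nor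
   when the exceptional set is nonempty (projective_metric). *)
Definition log_ratio (b a : \bar R) : \bar R :=
  if (b == +oo) || (a == 0) then +oo else (ln (fine b / fine a))%:E.

Definition hilbert_metric (V : lmodType R) (C : set V) (x y : V) : \bar R :=
  log_ratio
    (ereal_inf [set t%:E | t in [set t : R | (0 < t)%R /\ C (t *: x - y)%R]])
    (ereal_sup [set t%:E | t in [set t : R | (0 <= t)%R /\ C (y - t *: x)%R]]).

Definition exceptional_set (W : lmodType R[i]) (C : set W) (x y : W) :
  set R[i] := [set z | ~ C (z *: x - y)%R].

Definition projective_metric (W : lmodType R[i]) (C : set W) (x y : W) :
  \bar R :=
  log_ratio
    (ereal_sup [set (normc z)%:E | z in exceptional_set C x y])
    (ereal_inf [set (normc z)%:E | z in exceptional_set C x y]).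

Definition diameter (T : Type) (d : T -> T -> \bar R) (S : set T) : \bar R :=
  ereal_sup [set d x y | x in S & y in S].

End Metrics.

Definition coshR (R : realType) (x : R) : R := (expR x + expR (- x)) / 2.

(* Main.v *)
(* Put eta := 2 eps (1 + cosh (DeltaP / 2)) and, for x in C and l1, l2 in the
   dual cone, a_j := <l_j, P x>, w_j := <l_j, A x>, D := Re (a1 conj a2).
   The values <l, x> pairwise make acute angles, so after a rotation they all
   lie in the first quadrant; by Hahn-Banach x is then lam (u + iv) with u, v
   in the real cone. For such u, v the Hilbert diameter compares
   l1(Pu) l2(Pv) with l1(Pv) l2(Pu) up to a factor exp DeltaP, and this yields
     |w1 - a1| |a2| + |w2 - a2| |a1| + |w1 - a1| |w2 - a2| <= eta D,
   whence Re (w1 conj w2) >= (1 - eta) D, so A x is in C. If z A x - P x is not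
   in C, then Re ((z w1 - a1) conj (z w2 - a2)) <= 0 for some l1, l2 with
   D > 0; the roots of this quadratic inequality in |z| give
     1 / (1 + eta) <= |z| <= (1 + eta) / (1 - eta),
   and (1 + eta)^2 / (1 - eta) <= (1 - eta)^-3. *)
Require Import Defs.
From HB Require Import structures.
From mathcomp Require Import all_boot all_order all_algebra.
From mathcomp Require Import all_classical all_reals all_analysis.
From mathcomp Require Import complex.
From mathcomp Require Import ring lra.
Set Implicit Arguments.
Unset Strict Implicit.
Unset Printing Implicit Defensive.
Import Order.TTheory GRing.Theory Num.Theory.
Import numFieldNormedType.Exports.
Import ComplexField.Normc.
Local Open Scope classical_set_scope.
Local Open Scope complex_scope.
Local Open Scope ring_scope.

(** * Bounds on infima of sets of reals *)

Lemma le_infD (R : realType) (A B : set R) (c : R) :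
  A !=set0 -> B !=set0 -> (forall a b, A a -> B b -> c <= a + b) ->
  c <= inf A + inf B.
Proof.
move=> A0 B0 cAB; rewrite -lerBlDr; apply: lb_le_inf => // a Aa.
rewrite lerBlDr -lerBlDl; apply: lb_le_inf => // b Bb.
by rewrite lerBlDl; exact: cAB.
Qed.

Lemma le_infM (R : realType) (A : set R) (t c : R) : 0 < t ->
  A !=set0 -> (forall a, A a -> c <= t * a) -> c <= t * inf A.
Proof.
move=> t0 A0 cA; rewrite -ler_pdivrMl//; apply: lb_le_inf => // a Aa.
by rewrite ler_pdivrMl//; exact: cA.
Qed.

Lemma inf_le_mem (R : realType) (A : set R) (m a : R) :
  (forall x, A x -> m <= x) -> A a -> inf A <= a.
Proof. by move=> mA Aa; apply: ge_inf => //; exists m. Qed.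

(** * Hahn-Banach for sublinear functionals *)

Section HahnBanach.
Variables (R : realType) (V : lmodType R).
Implicit Types (p q : V -> R) (x y : V).

Definition sublinear q :=
  (forall x y, q (x + y) <= q x + q y) /\
  (forall t x, 0 < t -> q (t *: x) <= t * q x).

Lemma sublinear0 q : sublinear q -> q 0 = 0.
Proof.
move=> [qD qZ]; have := qD 0 0; rewrite addr0 => q0.
have := qZ 2^-1 0; rewrite scaler0 invr_gt0 ltr0n => /(_ isT) q0'.
by lra.
Qed.

Lemma sublinear_ge q x : sublinear q -> - q (- x) <= q x.
Proof.
move=> sq; have [qD _] := sq; have := qD x (- x).
by rewrite subrr sublinear0// -lerBlDr sub0r.
Qed.

(** For [q] sublinear, this is the largest sublinear functional below [q] whose value at [- y] is at
    most [- q y]. *)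
Definition push q y x :=
  inf [set q (x + t *: y) - t * q y | t in [set t | 0 <= t]].

Section Push.
Variables (q : V -> R) (y : V).
Hypothesis sq : sublinear q.

Let S x := [set q (x + t *: y) - t * q y | t in [set t | 0 <= t]].

Let S0 x : S x !=set0.
Proof. by exists (q (x + 0 *: y) - 0 * q y), 0 => /=. Qed.

(** A lower bound is what makes [inf] meaningful here; it comes from q (t y) <= q (x + t y) + q (-
    x). *)
Let S_lb x s : S x s -> - q (- x) <= s.
Proof.
have [qD qZ] := sq => -[t /= t0 <-].
have qty : t * q y <= q (t *: y).
  move: t0; rewrite le_eqVlt => /predU1P[<-|t0].
    by rewrite mul0r scale0r sublinear0.
  have := qZ t^-1 (t *: y); rewrite scalerA mulVf ?gt_eqF// scale1r invr_gt0.
  by move=> /(_ t0); rewrite ler_pdivlMl.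
have := qD (x + t *: y) (- x); rewrite addrAC subrr add0r; lra.
Qed.

Lemma push_le_at t x : 0 <= t -> push q y x <= q (x + t *: y) - t * q y.
Proof.
by move=> t0; apply: inf_le_mem; [exact: S_lb|exists t].
Qed.

Lemma push_le x : push q y x <= q x.
Proof.
by have := @push_le_at 0 x (lexx _); rewrite scale0r addr0 mul0r subr0.
Qed.

Lemma push_opp : push q y (- y) <= - q y.
Proof.
have := @push_le_at 1 (- y) ler01.
by rewrite scale1r addNr mul1r sublinear0// sub0r.
Qed.

Lemma push_sublinear : sublinear (push q y).
Proof.
have [qD qZ] := sq; split=> [x x'|k x k0].
  apply: (le_infD (S0 x) (S0 x')) => _ _ [t /= t0 <-] [t' /= t'0 <-].
  apply: le_trans (push_le_at _ (addr_ge0 t0 t'0)) _.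
  have := qD (x + t *: y) (x' + t' *: y).
  rewrite addrACA -scalerDl; lra.
apply: (le_infM k0 (S0 x)) => _ [t /= t0 <-].
apply: le_trans (push_le_at _ (mulr_ge0 (ltW k0) t0)) _.
by rewrite -scalerA -scalerDr mulrBr mulrA lerB// qZ.
Qed.

End Push.

Lemma minimal_sublinear p : sublinear p ->
  exists q, [/\ sublinear q, forall x, q x <= p x &
    forall q', sublinear q' -> (forall x, q' x <= q x) -> q' = q].
Proof.
move=> sp; pose T := {q | sublinear q /\ forall x, q x <= p x}.
(* The order is reversed, so the maximal element given by Zorn is a minimal functional; chains are
   bounded by their pointwise infimum. *)
pose le (a b : T) := `[< forall x, sval b x <= sval a x >].
have lb (F : T) x : - p (- x) <= sval F x.
  have [sF Fp] := svalP F; apply: le_trans (sublinear_ge x sF).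
  by rewrite lerN2 Fp.
have [||||[q [sq qp]] /= qmin] := @Zorn T le.
- by move=> a; apply/asboolP.
- move=> a b c /asboolP ab /asboolP bc; apply/asboolP => x.
  exact: le_trans (bc x) (ab x).
- move=> [a Ha] [b Hb] /asboolP/= ab /asboolP/= ba; apply: eq_exist.
  by apply/funext => x; apply/eqP; rewrite eq_le ab ba.
- move=> F Ftot; have [F0|/set0P[f0 Ff0]] := eqVneq F set0.
    have pp : sublinear p /\ forall x, p x <= p x by [].
    by exists (exist _ p pp) => s; rewrite F0.
  pose S x := [set sval f x | f in F]; pose m x := inf (S x).
  have S0 x : S x !=set0 by exists (sval f0 x), f0.
  have mle f x : F f -> m x <= sval f x.
    move=> Ff; apply: (@inf_le_mem _ _ (- p (- x))); last by exists f.
    by move=> _ [g _ <-].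
  have sm : sublinear m.
    split=> [x y|t x t0].
      apply: le_infD => // _ _ [f Ff <-] [g Fg <-].
      (* Of two members of the chain, the smaller one serves at both [x] and [y]. *)
      have [/asboolP fg|/asboolP gf] := Ftot f g Ff Fg.
        apply: le_trans (mle g (x + y) Fg) _.
        by apply: le_trans ((svalP g).1.1 x y) _; rewrite lerD2r.
      apply: le_trans (mle f (x + y) Ff) _.
      by apply: le_trans ((svalP f).1.1 x y) _; rewrite lerD2l.
    apply: le_infM => // _ [f Ff <-]; apply: le_trans (mle f _ Ff) _.
    exact: (svalP f).1.2.
  have mp : sublinear m /\ forall x, m x <= p x.
    by split=> // x; apply: le_trans (mle f0 x Ff0) _; exact: (svalP f0).2.
  by exists (exist _ m mp) => f Ff; apply/asboolP => x; exact: mle.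
exists q; split=> // q' sq' q'q.
have Hq' : sublinear q' /\ forall x, q' x <= p x.
  by split=> // x; exact: le_trans (qp x).
have := qmin (exist _ q' Hq'); move=> /(_ _)/(congr1 sval)/=; apply.
exact/asboolP.
Qed.

(* A minimal sublinear functional equals each of its pushes, so it is odd, and
   an odd sublinear functional is linear. *)
Lemma linear_below_sublinear p : sublinear p ->
  exists f : {linear V -> R^o}, forall x, f x <= p x.
Proof.
move=> /minimal_sublinear[q [sq qp qmin]].
have qN x : q (- x) = - q x.
  have := push_opp x sq.
  rewrite (qmin _ (push_sublinear x sq) (push_le x sq)) => qNx.
  apply/eqP; rewrite eq_le qNx/=; have := sublinear_ge (- x) sq.
  by rewrite opprK.
have [qD qZ] := sq.
have qDe x y : q (x + y) = q x + q y.
  apply/eqP; rewrite eq_le qD/=; have := qD (- x) (- y).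
  by rewrite -opprD !qN -opprD lerN2.
have qZp t x : 0 < t -> q (t *: x) = t * q x.
  move=> t0; apply/eqP; rewrite eq_le qZ//=; have := qZ t (- x) t0.
  by rewrite scalerN !qN mulrN lerN2.
have qZe t x : q (t *: x) = t * q x.
  have [t0|t0|->] := ltgtP t 0; last by rewrite scale0r mul0r sublinear0.
    by rewrite -[t]opprK scaleNr qN qZp ?oppr_gt0// !mulNr.
  exact: qZp.
have qlin : linear (q : V -> R^o) by move=> a x y; rewrite qDe qZe.
pose mx := GRing.isLinear.Build _ _ _ _ (q : V -> R^o) qlin.
pose f : {linear V -> R^o} := HB.pack (q : V -> R^o) mx.
by exists f.
Qed.

(** A linear [f] below [push p x0] satisfies f (- x0) <= - p x0, which is the missing inequality p
    x0 <= f x0. *)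
Lemma hahn_banach_at p x0 : sublinear p ->
  exists f : {linear V -> R^o}, (forall x, f x <= p x) /\ f x0 = p x0.
Proof.
move=> sp; have [f fp] := linear_below_sublinear (push_sublinear x0 sp).
have fp' x : f x <= p x := le_trans (fp x) (push_le x0 sp x).
exists f; split=> //; apply/eqP; rewrite eq_le fp'/=.
have := le_trans (fp (- x0)) (push_opp x0 sp).
by rewrite linearN lerN2.
Qed.

End HahnBanach.

(** * Separation of a point from a closed convex cone *)

Section Separation.
Variables (R : realType) (V : normedModType R) (C : set V).
Hypotheses (C_closed : closed C) (C_cone : convex_cone C).

Let p (x : V) : R := inf [set `|x - c| | c in C].

Lemma dist_cone_le x c : C c -> p x <= `|x - c|.
Proof.
move=> Cc; apply: (@inf_le_mem _ _ 0); last by exists c.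
by move=> _ [d _ <-].
Qed.

Lemma dist_cone_sublinear : C !=set0 -> sublinear p.
Proof.
move=> [c0 Cc0]; have [CD CZ] := C_cone.
have S0 x : [set `|x - c| | c in C] !=set0 by exists `|x - c0|, c0.
split=> [x y|t x t0].
  apply: le_infD => // _ _ [c Cc <-] [d Cd <-].
  apply: le_trans (dist_cone_le _ (CD _ _ Cc Cd)) _.
  by rewrite opprD addrACA ler_normD.
apply: le_infM => // _ [c Cc <-].
apply: le_trans (dist_cone_le _ (CZ _ _ (ltW t0) Cc)) _.
by rewrite -scalerBr normrZ gtr0_norm.
Qed.

(** For [x] outside [C], take a linear [f] below the distance to [C] with equality at [x]. The
    distance is at most the norm, so [f] is continuous; it vanishes on [C], so - f is in the dual
    cone; it is positive at [x] because [C] is closed. *)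
Lemma dual_cone_separation x : C !=set0 ->
  (forall l : {linear V -> R^o}, dual_cone C l -> 0 <= l x) -> C x.
Proof.
move=> C0 lx; apply: contrapT => nCx.
have C_0 : C 0 by have [c /(C_cone.2 0 c (lexx _))] := C0; rewrite scale0r.
have [f [fp fx]] := hahn_banach_at x (dist_cone_sublinear C0).
have px : 0 < p x.
  have /nbhs_normP[e /= e0 eC] : nbhs x (~` C).
    by apply: open_nbhs_nbhs; split=> //; exact: closed_openC.
  apply: lt_le_trans e0 _; apply: lb_le_inf => [|_ [c Cc <-]].
    by have [c Cc] := C0; exists `|x - c|, c.
  by rewrite leNgt; apply/negP => /eC.
have fle y : f y <= `|y|.
  by apply: le_trans (fp y) _; rewrite -{2}[y]subr0; exact: dist_cone_le.
have fcont : continuous f.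
  apply/linear_bounded_continuous/linear_boundedP; near=> r => y.
  apply: (@le_trans _ _ `|y|).
    by rewrite ler_norml fle andbT lerNl -linearN -normrN fle.
  by rewrite ler_peMl//; near: r; exact: nbhs_pinfty_ge.
suff /lx/= : dual_cone C (\- f : V -> R^o).
  by rewrite oppr_ge0 leNgt fx px.
split=> [|c Cc]; first by move=> y; apply: cvgN; exact: fcont.
rewrite /= oppr_ge0; apply: le_trans (fp c) _.
by apply: le_trans (dist_cone_le c Cc) _; rewrite subrr normr0.
Unshelve. all: by end_near. Qed.

End Separation.

(** * Real inequalities behind the constant 1 + cosh (Delta / 2) *)

Lemma coshR_ge1 (R : realType) (t : R) : 1 <= coshR t.
Proof.
rewrite /coshR expRN ler_pdivlMr// mul1r.
have k0 := expR_gt0 t; rewrite -(ler_pM2l k0).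
have : expR t * (expR t)^-1 = 1 by rewrite mulfV ?gt_eqF.
have := sqr_ge0 (expR t - 1); move: (_^-1) => k'; lra.
Qed.

Section QuadrantEstimate.
Variable R : realType.

(** The relation between [k] and [c] reads c = (k + 1/k) / 2, so [c] is a cosh when [k] is an
    exponential. The inequality is (k b - a) (k a - b) >= 0 expanded. *)
Lemma cosh_sum_le (k c a b : R) : 0 < k -> 0 <= a -> 0 <= b ->
  k ^+ 2 + 1 = 2 * c * k -> a <= k * b -> b <= k * a ->
  a ^+ 2 + b ^+ 2 <= 2 * c * (a * b).
Proof.
move=> k0 a0 b0 kc akb bka; rewrite -(ler_pM2l k0).
have -> : k * (2 * c * (a * b)) = (k ^+ 2 + 1) * (a * b) by rewrite kc; ring.
have : 0 <= (k * b - a) * (k * a - b) by rewrite mulr_ge0// subr_ge0.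
lra.
Qed.

(** The square of the right side exceeds that of the left by exactly (x y)^4. *)
Lemma norm_sum_le (x y n : R) : 0 <= n -> 0 <= x -> 0 <= y ->
  n ^+ 2 = (x ^+ 2) ^+ 2 + (y ^+ 2) ^+ 2 ->
  (x ^+ 2 + y ^+ 2) * n <= (x ^+ 2 + y ^+ 2) ^+ 2 - (x * y) ^+ 2.
Proof.
move=> n0 x0 y0 n2; rewrite -ler_sqr ?nnegrE.
- rewrite exprMn n2 -subr_ge0; set d := (X in 0 <= X).
  have -> : d = ((x * y) ^+ 2) ^+ 2 by rewrite /d; ring.
  exact: sqr_ge0.
- by rewrite mulr_ge0// addr_ge0// sqr_ge0.
- rewrite subr_ge0 ler_sqr ?nnegrE ?mulr_ge0 ?addr_ge0 ?sqr_ge0//.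
  by have := sqr_ge0 (x - y); have := mulr_ge0 x0 y0; nra.
Qed.

(** After multiplication by s1 s2, the two instances of [norm_sum_le], weighted by s2^2 and s1^2,
    leave the square of s1 x2 y2 - s2 x1 y1. *)
Lemma cross_sum_le (x1 y1 x2 y2 n1 n2 : R) :
  0 <= x1 -> 0 <= y1 -> 0 <= x2 -> 0 <= y2 -> 0 <= n1 -> 0 <= n2 ->
  n1 ^+ 2 = (x1 ^+ 2) ^+ 2 + (y1 ^+ 2) ^+ 2 ->
  n2 ^+ 2 = (x2 ^+ 2) ^+ 2 + (y2 ^+ 2) ^+ 2 ->
  (x1 ^+ 2 + y1 ^+ 2) * n2 + (x2 ^+ 2 + y2 ^+ 2) * n1 + 2 * (x1 * y1 * x2 * y2)
  <= 2 * ((x1 ^+ 2 + y1 ^+ 2) * (x2 ^+ 2 + y2 ^+ 2)).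
Proof.
move=> x1_0 y1_0 x2_0 y2_0 n1_0 n2_0 n1E n2E.
set s1 := x1 ^+ 2 + y1 ^+ 2; set s2 := x2 ^+ 2 + y2 ^+ 2.
have degenerate (x y n : R) : 0 = x ^+ 2 + y ^+ 2 ->
    n ^+ 2 = (x ^+ 2) ^+ 2 + (y ^+ 2) ^+ 2 -> x = 0 /\ n = 0.
  move/esym/eqP; rewrite paddr_eq0 ?sqr_ge0// !sqrf_eq0 => /andP[/eqP-> /eqP->].
  by move=> nE; split=> //; apply/eqP; rewrite -sqrf_eq0 nE; apply/eqP; ring.
have : 0 <= s1 by rewrite addr_ge0 ?sqr_ge0.
rewrite le_eqVlt => /predU1P[s1E|s1_0].
  by have [-> ->] := degenerate _ _ _ s1E n1E; rewrite -s1E; lra.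
have : 0 <= s2 by rewrite addr_ge0 ?sqr_ge0.
rewrite le_eqVlt => /predU1P[s2E|s2_0].
  by have [-> ->] := degenerate _ _ _ s2E n2E; rewrite -s2E; lra.
have h1 := norm_sum_le n1_0 x1_0 y1_0 n1E.
have h2 := norm_sum_le n2_0 x2_0 y2_0 n2E.
rewrite -/s1 in h1; rewrite -/s2 in h2.
rewrite -(ler_pM2l (mulr_gt0 s1_0 s2_0)).
have := ler_wpM2l (sqr_ge0 s1) h2; have := ler_wpM2l (sqr_ge0 s2) h1.
have := sqr_ge0 (s1 * (x2 * y2) - s2 * (x1 * y1)).
lra.
Qed.

(** To be read with p_j + i q_j = <l_j, P (u + iv)>, n_j its modulus, f_j the modulus of the
    perturbation, k = exp (Delta / 2) and c = cosh (Delta / 2). *)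
Lemma quadrant_error_le (eps k c p1 q1 p2 q2 n1 n2 f1 f2 : R) :
  0 < k -> 1 <= c -> k ^+ 2 + 1 = 2 * c * k ->
  0 < eps -> 2 * eps * (1 + c) <= 1 ->
  0 <= p1 -> 0 <= q1 -> 0 <= p2 -> 0 <= q2 -> 0 <= n1 -> 0 <= n2 ->
  n1 ^+ 2 = p1 ^+ 2 + q1 ^+ 2 -> n2 ^+ 2 = p2 ^+ 2 + q2 ^+ 2 ->
  p1 * q2 <= k ^+ 2 * (p2 * q1) -> p2 * q1 <= k ^+ 2 * (p1 * q2) ->
  0 <= f1 <= eps * (p1 + q1) -> 0 <= f2 <= eps * (p2 + q2) ->
  f1 * n2 + f2 * n1 + f1 * f2 <= 2 * eps * (1 + c) * (p1 * p2 + q1 * q2).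
Proof.
move=> k0 c1 kc e0 ec.
(* With p_j = x_j^2, q_j = y_j^2 and g the geometric mean of p1 q2 and p2 q1,
   the claim reduces to an inequality affine in g, valid at both ends of the
   range 0 <= g <= D / 2. *)
move=> /sqr_sqrtr<- /sqr_sqrtr<- /sqr_sqrtr<- /sqr_sqrtr<- n1_0 n2_0.
have := sqrtr_ge0 p1; have := sqrtr_ge0 q1.
have := sqrtr_ge0 p2; have := sqrtr_ge0 q2.
move: (Num.sqrt p1) (Num.sqrt p2) (Num.sqrt q1) (Num.sqrt q2).
move=> x1 x2 y1 y2 y2_0 x2_0 y1_0 x1_0 n1E n2E XY YX.
move=> /andP[f1_0 f1_le] /andP[f2_0 f2_le].
have kM a b : 0 <= a -> 0 <= b -> a ^+ 2 <= k ^+ 2 * b ^+ 2 -> a <= k * b.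
  by move=> a0 b0; rewrite -exprMn ler_sqr ?nnegrE// mulr_ge0// ltW.
have Xb : x1 * y2 <= k * (x2 * y1).
  by apply: kM; rewrite ?mulr_ge0// !exprMn.
have Yb : x2 * y1 <= k * (x1 * y2).
  by apply: kM; rewrite ?mulr_ge0// !exprMn.
have sumXY := cosh_sum_le k0 (mulr_ge0 x1_0 y2_0) (mulr_ge0 x2_0 y1_0) kc Xb Yb.
have cross := cross_sum_le x1_0 y1_0 x2_0 y2_0 n1_0 n2_0 n1E n2E.
set s1 := x1 ^+ 2 + y1 ^+ 2 in f1_le cross *.
set s2 := x2 ^+ 2 + y2 ^+ 2 in f2_le cross *.
set g := x1 * y1 * x2 * y2 in cross.
set D := x1 ^+ 2 * x2 ^+ 2 + y1 ^+ 2 * y2 ^+ 2.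
have s1_0 : 0 <= s1 by rewrite addr_ge0 ?sqr_ge0.
have s2_0 : 0 <= s2 by rewrite addr_ge0 ?sqr_ge0.
have gD : 2 * g <= D.
  by have := sqr_ge0 (x1 * x2 - y1 * y2); rewrite /g /D; lra.
have g0 : 0 <= g by rewrite !mulr_ge0.
(* s1 s2 is [D] plus the mixed terms (x1 y2)^2 + (x2 y1)^2, which the cosh bound controls. *)
have s12 : s1 * s2 <= D + 2 * c * g by move: sumXY; rewrite /s1 /s2 /D /g; lra.
have h1 := ler_wpM2r n2_0 f1_le.
have h2 := ler_wpM2r n1_0 f2_le.
have h3 : f1 * f2 <= eps * s1 * (eps * s2) by exact: ler_pM.
apply: (@le_trans _ _ (eps * (s1 * n2 + s2 * n1 + eps * (s1 * s2)))); first lra.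
rewrite (_ : 2 * eps * (1 + c) * D = eps * (2 * (1 + c) * D)); last by ring.
rewrite ler_pM2l//.
have e2 : 0 <= 2 + eps by lra.
have h4 := ler_wpM2l e2 s12.
(* This is the coefficient of [g]; being nonnegative, it allows replacing [g] by D / 2. What then
   remains is D (1 - eps - c eps) >= 0. *)
have ec2 : 0 <= 4 * c + 2 * c * eps - 2.
  by have := mulr_ge0 (le_trans ler01 c1) (ltW e0); lra.
have h5 := ler_wpM2l ec2 gD.
have h6 : 0 <= D * (1 - eps - c * eps).
  by rewrite mulr_ge0//; lra.
lra.
Qed.

End QuadrantEstimate.

(** * Perturbation of products of complex numbers *)

Section ComplexEstimates.
Variable R : realType.
Implicit Types (z a w : R[i]) (r m d W D eta : R).

Lemma Re_le_normc z : complex.Re z <= normc z.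
Proof.
case: z => x y /=; apply: le_trans (ler_norm x) _.
by rewrite -sqrtr_sqr ler_wsqrtr// lerDl sqr_ge0.
Qed.

Lemma normc_ge0 z : 0 <= normc z.
Proof. by case: z => x y; exact: sqrtr_ge0. Qed.

Lemma normc_conj z : normc z^*%C = normc z.
Proof. by case: z => x y /=; rewrite sqrrN. Qed.

Lemma normc_opp z : normc (- z) = normc z.
Proof. by case: z => x y /=; rewrite !sqrrN. Qed.

Lemma normc_le_add z z' : normc (z + z') <= normc z + normc z'.
Proof. exact: le_normcD. Qed.

Lemma normc_sqr z : normc z ^+ 2 = complex.Re z ^+ 2 + complex.Im z ^+ 2.
Proof. by case: z => x y /=; rewrite sqr_sqrtr// addr_ge0// sqr_ge0. Qed.

Lemma normc_real (x : R) : 0 <= x -> normc x%:C = x.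
Proof. by move=> x0; rewrite /= expr0n/= addr0 sqrtr_sqr ger0_norm. Qed.

Lemma normc_gt0 z : z != 0 -> 0 < normc z.
Proof.
move=> z0; rewrite lt_neqAle normc_ge0 andbT eq_sym.
by apply: contra z0 => /eqP/eq0_normc ->.
Qed.

Lemma Re_mul_conj_gt0 z : z != 0 -> 0 < complex.Re (z * z^*%C).
Proof.
move=> /normc_gt0 z0; rewrite (_ : complex.Re _ = normc z ^+ 2) ?exprn_gt0//.
by rewrite normc_sqr; case: (z) => x y /=; ring.
Qed.

(** Expanding w_j = a_j + (w_j - a_j) gives three error terms, each at least minus the product of
    the moduli. *)
Lemma Re_mul_conj_ge a1 a2 w1 w2 eta :
  normc (w1 - a1) * normc a2 + normc (w2 - a2) * normc a1
    + normc (w1 - a1) * normc (w2 - a2) <= eta * complex.Re (a1 * a2^*%C) ->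
  (1 - eta) * complex.Re (a1 * a2^*%C) <= complex.Re (w1 * w2^*%C).
Proof.
move=> err.
have hN z z' : - complex.Re (z * z'^*%C) <= normc z * normc z'.
  rewrite -(normc_conj z') -normcM -normc_opp; apply: le_trans (Re_le_normc _).
  by case: (_ * _).
have := hN (w1 - a1) a2; have := hN a1 (w2 - a2).
have := hN (w1 - a1) (w2 - a2).
move: err; move: (normc _) (normc _) (normc _) (normc _).
case: a1 a2 w1 w2 => [a1 b1] [a2 b2] [w1 v1] [w2 v2] /= *.
by lra.
Qed.

(** Since d^2 is the discriminant, [r] lies between the roots 2 D / (m + d) and (m + d) / (2 W); the
    bounds on m + d and [W] conclude. *)
Lemma quadratic_root_bounds r m d W D eta : 0 <= r -> 0 <= m -> 0 <= d ->
  0 < D -> 0 <= eta < 1 -> (1 - eta) * D <= W ->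
  m ^+ 2 = 4 * W * D + d ^+ 2 -> m + d <= 2 * D * (1 + eta) ->
  r ^+ 2 * W - r * m + D <= 0 ->
  (1 + eta)^-1 <= r <= (1 + eta) / (1 - eta).
Proof.
move=> r0 m0 d0 D0 /andP[eta0 eta1] WD mE md quad.
have sub_le (x y : R) : 0 <= y -> x ^+ 2 <= y ^+ 2 -> x <= y.
  move=> y0; rewrite -(real_normK (num_real x)) ler_sqr ?nnegrE// => xy.
  exact: le_trans (ler_norm x) xy.
have W0 : 0 < W by apply: lt_le_trans WD; rewrite mulr_gt0// subr_gt0.
have upper : 2 * W * r - m <= d.
  apply: sub_le => //.
  have -> : d ^+ 2 = m ^+ 2 - 4 * W * D by lra.
  by have := mulr_ge0_le0 (ltW W0) quad; lra.
(* The square is completed at the constant term, which avoids dividing by [r]. *)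
have lower : 2 * D - r * m <= r * d.
  apply: sub_le; first exact: mulr_ge0.
  have dE : d ^+ 2 = m ^+ 2 - 4 * W * D by lra.
  by have := mulr_ge0_le0 (ltW D0) quad; rewrite exprMn dE; lra.
apply/andP; split.
  rewrite -div1r ler_pdivrMr; last by lra.
  have := ler_wpM2l r0 md => h.
  by rewrite -(ler_pM2l D0); lra.
rewrite ler_pdivlMr ?subr_gt0//.
have := ler_wpM2r r0 WD => h.
by rewrite -(ler_pM2l D0); lra.
Qed.

(** The disjunction reflects the two ways for a vector not to be in the complex cone without 0: a
    negative real part for some pair of functionals, or being 0. *)
Lemma exceptional_norm_bounds a1 a2 w1 w2 z eta : 0 < eta < 1 ->
  normc (w1 - a1) * normc a2 + normc (w2 - a2) * normc a1
    + normc (w1 - a1) * normc (w2 - a2) <= eta * complex.Re (a1 * a2^*%C) ->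
  complex.Re ((z * w1 - a1) * (z * w2 - a2)^*%C) < 0 \/
  complex.Re ((z * w1 - a1) * (z * w2 - a2)^*%C) <= 0 /\
    0 < complex.Re (a1 * a2^*%C) ->
  (1 + eta)^-1 <= normc z <= (1 + eta) / (1 - eta).
Proof.
move=> /andP[eta0 eta1] err zE.
have WD := Re_mul_conj_ge err.
set D := complex.Re (a1 * _) in err zE WD *.
set W := complex.Re (w1 * _) in WD.
(* The real part in zE equals |z|^2 W - Re (z s) + D, and the discriminant
   |s|^2 - 4 W D is the perfect square |d|^2. *)
pose s := w1 * a2^*%C + w2 * a1^*%C; pose d := w1 * a2 - w2 * a1.
have n0 := normc_ge0.
have E0 : normc (w1 - a1) * normc a2 + normc (w2 - a2) * normc a1 <= eta * D.
  by apply: le_trans err; rewrite lerDl mulr_ge0.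
have D0 : 0 <= D.
  rewrite -(pmulr_rge0 _ eta0); apply: le_trans E0.
  by rewrite addr_ge0// mulr_ge0.
(* Together with [dle] this gives |s| + |d| <= 2 D (1 + eta). *)
have sle : normc s <= 2 * D + eta * D.
  have -> : s = (2 * D)%:C + ((w1 - a1) * a2^*%C + (w2 - a2) * a1^*%C).
    rewrite /s /D; case: (a1) (a2) (w1) (w2) => [? ?] [? ?] [? ?] [? ?].
    by congr (_ +i* _) => /=; ring.
  apply: le_trans (normc_le_add _ _) _; rewrite normc_real ?mulr_ge0//.
  rewrite lerD2l; apply: le_trans (normc_le_add _ _) _.
  by rewrite !normcM !normc_conj.
have dle : normc d <= eta * D.
  have -> : d = (w1 - a1) * a2 + (- ((w2 - a2) * a1)) by rewrite /d; ring.
  by apply: le_trans (normc_le_add _ _) _; rewrite normc_opp !normcM.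
have sE : normc s ^+ 2 = 4 * W * D + normc d ^+ 2.
  rewrite !normc_sqr /s /d /W /D.
  case: (a1) (a2) (w1) (w2) => [? ?] [? ?] [? ?] [? ?] /=; ring.
have quad : normc z ^+ 2 * W - normc z * normc s + D <=
    complex.Re ((z * w1 - a1) * (z * w2 - a2)^*%C).
  have -> : complex.Re ((z * w1 - a1) * (z * w2 - a2)^*%C) =
      normc z ^+ 2 * W - complex.Re (z * s) + D.
    rewrite normc_sqr /s /W /D.
    by case: (z) (a1) (a2) (w1) (w2) => [? ?] [? ?] [? ?] [? ?] [? ?] /=; ring.
  by rewrite lerD2r lerD2l lerN2 -normcM Re_le_normc.
have {zE} [zE Dp] :
    complex.Re ((z * w1 - a1) * (z * w2 - a2)^*%C) <= 0 /\ 0 < D.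
  case: zE => // zE; split; first exact: ltW.
  (* If D = 0 then s = 0, and [quad] bounds the real part below by |z|^2 W >= 0. *)
  move: D0; rewrite le_eqVlt => /predU1P[D0|//]; exfalso.
  have s0 : normc s = 0.
    by apply/eqP; rewrite eq_le n0 andbT (le_trans sle)// -D0 !mulr0 addr0.
  move: (le_lt_trans quad zE); rewrite s0 mulr0 subr0 -D0 addr0 ltNge.
  by rewrite mulr_ge0 ?sqr_ge0// (le_trans _ WD)// -D0 mulr0.
apply: (@quadratic_root_bounds _ (normc s) (normc d) W D) => //.
- by rewrite ltW.
- lra.
- exact: le_trans quad zE.
Qed.

End ComplexEstimates.

(** * Bounding the logarithm of a supremum over an infimum *)

Lemma log_ratio_le (R : realType) (F : set (\bar R)) (lo hi : R) :
  0 < lo -> lo <= hi -> (forall x, F x -> (lo%:E <= x <= hi%:E)%E) ->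
  (log_ratio (ereal_sup F) (ereal_inf F) <= (ln (hi / lo))%:E)%E.
Proof.
move=> lo0 lohi Fb.
have hi0 : 0 < hi := lt_le_trans lo0 lohi.
have [->|/set0P[x0 Fx0]] := eqVneq F set0.
  (* On the empty set [fine] sends both infinities to 0 and [ln] is 0 there, which is below the
     bound. *)
  rewrite /log_ratio ereal_sup0 ereal_inf0 /= mul0r ln0// lee_fin ln_ge0//.
  by rewrite ler_pdivlMr// mul1r.
have /andP[x0lo x0hi] := Fb _ Fx0.
have suphi : (ereal_sup F <= hi%:E)%E.
  by apply: ge_ereal_sup => x /Fb/andP[].
have inflo : (lo%:E <= ereal_inf F)%E.
  by apply: le_ereal_inf_tmp => x /Fb/andP[].
have suplo : (lo%:E <= ereal_sup F)%E.
  by apply: le_trans x0lo _; exact: ereal_sup_ubound.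
have infhi : (ereal_inf F <= hi%:E)%E.
  by apply: le_trans x0hi; exact: ereal_inf_lbound.
move: suphi inflo suplo infhi; rewrite /log_ratio.
case: (ereal_sup F) => [b| |]//; case: (ereal_inf F) => [a| |]//.
rewrite !lee_fin => bhi alo blo ahi /=.
have a0 : 0 < a := lt_le_trans lo0 alo.
have b0 : 0 < b := lt_le_trans lo0 blo.
rewrite eqe gt_eqF//= lee_fin ler_ln ?posrE ?divr_gt0//.
apply: ler_pM => //; [exact: ltW|by rewrite invr_ge0 ltW|].
by rewrite lef_pV2 ?posrE.
Qed.

(** * The Hilbert metric seen through the dual cone *)

Section DualCone.
Variables (R : realType) (V : normedModType R) (C : set V).
Hypotheses (C_closed : closed C) (C_cone : convex_cone C).
Hypothesis C_proper : proper_cone C.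

(** Otherwise the whole dual cone is nonnegative at - u, so separation puts - u in [C], against
    properness. *)
Lemma dual_cone_pos u : C u -> u != 0 ->
  exists2 l : {linear V -> R^o}, dual_cone C l & 0 < l u.
Proof.
move=> Cu u0; apply: contrapT => nl; move/eqP: u0; apply.
suff : (C `&` (-%R @` C)) u by rewrite C_proper.
split=> //; exists (- u); rewrite ?opprK//.
apply: dual_cone_separation => //; first by exists u.
move=> l Cl; rewrite linearN oppr_ge0 leNgt; apply/negP => lu.
by apply: nl; exists l.
Qed.

(** With a, b the two extremal factors of the metric, a l(u) <= l(v) <= b l(u) for every [l] in the
    dual cone, and b <= exp(D) a. *)
Lemma hilbert_metric_dual u v (D : R) (l1 l2 : {linear V -> R^o}) :
  C u -> u != 0 -> C v -> v != 0 -> (hilbert_metric C u v <= D%:E)%E ->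
  dual_cone C l1 -> dual_cone C l2 -> l1 v * l2 u <= expR D * (l1 u * l2 v).
Proof.
move=> Cu u0 Cv v0; rewrite /hilbert_metric /log_ratio.
set B := ereal_inf _; set A := ereal_sup _.
case: ifPn => [|]; first by rewrite leye_eq.
rewrite negb_or => /andP[Boo A0] lnBA Cl1 Cl2.
(* [k] makes the supremum [A] finite; [k'] makes the infimum [B] nonzero. *)
have [k Ck ku] := dual_cone_pos Cu u0.
have [k' Ck' kv] := dual_cone_pos Cv v0.
have A_ge0 : (0 <= A)%E.
  apply: ereal_sup_ubound; exists 0 => //=.
  by rewrite lexx scale0r subr0.
have A_ub (l : {linear V -> R^o}) :
    dual_cone C l -> 0 < l u -> (A <= (l v / l u)%:E)%E.
  move=> [_ Cl] lu; apply: ge_ereal_sup => _ [t /= [t0 Ct] <-].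
  rewrite lee_fin ler_pdivlMr//; have := Cl _ Ct.
  by rewrite linearB linearZ subr_ge0.
have B_ge0 : (0 <= B)%E.
  by apply: le_ereal_inf_tmp => _ [t /= [t0 _] <-]; rewrite lee_fin ltW.
have B_lb (l : {linear V -> R^o}) :
    dual_cone C l -> 0 < l u -> ((l v / l u)%:E <= B)%E.
  move=> [_ Cl] lu; apply: le_ereal_inf_tmp => _ [t /= [t0 Ct] <-].
  rewrite lee_fin ler_pdivrMr//; have := Cl _ Ct.
  by rewrite linearB linearZ subr_ge0.
(* This settles functionals with l u = 0, for which the quotient l v / l u says nothing: it forces l
   v = 0. *)
have [t0 Ct0] : exists t, C (t *: u - v).
  apply: contrapT => nt; move/eqP: Boo; apply.
  rewrite /B (_ : [set _ | _ in _] = set0) ?ereal_inf0//.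
  by rewrite -subset0 => _ [t /= [_ Ct] _]; apply: nt; exists t.
have := A_ub k Ck ku.
move: Boo A0 lnBA A_ge0 A_ub B_ge0 B_lb.
case: A => [a| |]//; case: B => [b| |]//= _ a_neq0.
rewrite !lee_fin => lnba a_ge0 A_ub b_ge0 B_lb _.
have a0 : 0 < a.
  by rewrite lt_neqAle a_ge0 andbT eq_sym; apply: contra a_neq0 => /eqP->.
have l_le (l : {linear V -> R^o}) : dual_cone C l -> a * l u <= l v <= b * l u.
  move=> Cl; have := Cl.2 _ Cu; rewrite le_eqVlt => /predU1P[lu|lu].
    rewrite -lu !mulr0 Cl.2//=; have := Cl.2 _ Ct0.
    by rewrite linearB linearZ/= -lu scaler0 sub0r oppr_ge0.
  have := A_ub l Cl lu; have := B_lb l Cl lu.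
  by rewrite !lee_fin ler_pdivrMr// ler_pdivlMr// => -> ->.
have b0 : 0 < b.
  have /andP[_] := l_le k' Ck'; move/(lt_le_trans kv) => bk.
  rewrite lt_neqAle b_ge0 andbT; apply/eqP => b0; move: bk.
  by rewrite -b0 mul0r ltxx.
have ba : b <= expR D * a.
  by rewrite -ler_pdivrMr// -[b / a]lnK ?ler_expR// posrE divr_gt0.
have /andP[_ h1] := l_le l1 Cl1; have /andP[h2 _] := l_le l2 Cl2.
have l1u := Cl1.2 _ Cu; have l2u := Cl2.2 _ Cu.
apply: (le_trans (ler_wpM2r l2u h1)).
apply: (@le_trans _ _ (expR D * (l1 u * (a * l2 u)))); last first.
  by rewrite ler_wpM2l ?expR_ge0// ler_wpM2l.
by have := ler_wpM2r (mulr_ge0 l1u l2u) ba; lra.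
Qed.

End DualCone.

(** * Rotating a pairwise acute family into the first quadrant *)

Section Rotation.
Variable R : realType.

Lemma acute_family_right_half_plane (Z : set R[i]) (n : R) :
  0 < n -> Z n%:C -> (forall z, Z z -> 0 <= complex.Re z) ->
  (forall z z', Z z -> Z z' -> 0 <= complex.Re (z * z'^*%C)) ->
  exists2 mu : R[i], mu != 0 &
    forall z, Z z -> 0 <= complex.Re (mu * z) /\ 0 <= complex.Im (mu * z).
Proof.
move=> n0 Zn Zre Zacute.
have acute x y x' y' : Z (x +i* y) -> Z (x' +i* y') -> 0 <= x * x' + y * y'.
  by move=> Zz Zz'; have := Zacute _ _ Zz Zz'; rewrite /= mulrN opprK.
(* If the family lies in the fourth quadrant, a quarter turn suffices; slopes may then be unbounded
   below, so this case is kept apart. *)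
have [Zim|] := pselect (forall z, Z z -> complex.Im z <= 0).
  exists 'i; first by rewrite eq_complex/= negb_and oner_eq0 orbT.
  move=> [x y] Zz /=; have := Zim _ Zz; have := Zre _ Zz => /=; lra.
move=> /existsNP[[x1 y1]] /not_implyP[Zz1] /= /negP; rewrite -ltNge => y1_0.
have x1_0 : 0 <= x1 := Zre _ Zz1.
(* The rotation by 1 - i m brings the ray of least slope to the real axis. *)
pose T := [set t | exists x y, [/\ Z (x +i* y), 0 < x & t = y / x]].
have T0 : T 0 by exists n, 0; rewrite mul0r.
(* Acuteness against a point above the real axis bounds all slopes from below. *)
have T_lb x y : Z (x +i* y) -> 0 < y -> lbound T (- (x / y)).
  move=> Zz y0 _ [x' [y' [Zz' x'0 ->]]].
  rewrite ler_pdivlMr// mulNr mulrAC lerNl ler_pdivlMr//.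
  have := acute _ _ _ _ Zz Zz'; lra.
have T_has : has_lbound T by exists (- (x1 / y1)); exact: T_lb.
set m := inf T.
have m0 : m <= 0 by apply: ge_inf.
exists (1 -i* m); first by rewrite eq_complex/= oner_eq0.
move=> [x y] Zz /=; have x0 : 0 <= x := Zre _ Zz.
split.
  have [y0|y0] := lerP y 0; first by have := mulr_le0 m0 y0; lra.
  have : - (x / y) <= m by apply: lb_le_inf; [exists 0|exact: T_lb].
  by rewrite lerNl ler_pdivlMr//; lra.
(* A point on the imaginary axis has no slope in [T]; acuteness against x1 + i y1 shows y >= 0. *)
move: x0; rewrite le_eqVlt => /predU1P[x0|x0].
  have := acute _ _ _ _ Zz Zz1; rewrite -x0 mul0r add0r pmulr_lge0//; lra.
have : m <= y / x by apply: ge_inf => //; exists x, y.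
by rewrite ler_pdivlMr//; lra.
Qed.

(** Multiplying by the conjugate of a nonzero member makes that member a positive real and, by
    acuteness, moves the family into the right half plane. *)
Lemma acute_family_quadrant (Z : set R[i]) :
  (forall z z', Z z -> Z z' -> 0 <= complex.Re (z * z'^*%C)) ->
  exists2 mu : R[i], mu != 0 &
    forall z, Z z -> 0 <= complex.Re (mu * z) /\ 0 <= complex.Im (mu * z).
Proof.
move=> Zacute.
have [Z0|/existsNP[z0 /not_implyP[Zz0 /eqP z0_neq0]]] :=
    pselect (forall z, Z z -> z = 0).
  by exists 1; [exact: oner_neq0|move=> z /Z0 ->; rewrite mulr0].
pose Z' := [set z0^*%C * z | z in Z].
have [||||mu mu0 muZ'] := @acute_family_right_half_plane Z' (normc z0 ^+ 2).
- by rewrite exprn_gt0// normc_gt0.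
- exists z0 => //; rewrite normc_sqr.
  by case: (z0) => x y; congr (_ +i* _) => /=; ring.
- by move=> _ [z Zz <-]; rewrite mulrC; exact: Zacute.
- move=> _ _ [z Zz <-] [z' Zz' <-].
  have -> : complex.Re (z0^*%C * z * (z0^*%C * z')^*%C) =
      normc z0 ^+ 2 * complex.Re (z * z'^*%C).
    rewrite normc_sqr.
    by case: (z0) (z) (z') => [? ?] [? ?] [? ?] /=; ring.
  by rewrite mulr_ge0 ?sqr_ge0// Zacute.
exists (mu * z0^*%C); first by rewrite mulf_neq0// conjc_eq0.
by move=> z Zz; rewrite -mulrA; apply: muZ'; exists z.
Qed.

End Rotation.

(** * Pairings and the structure of the complexified cone *)

Section Complexification.
Variables (R : realType) (V : normedModType R).
Implicit Types (l : {linear V -> R^o}) (x y : complexification V).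

Lemma pairing0 l : pairing l (0 : complexification V) = 0.
Proof. by rewrite /pairing /= linear0. Qed.

Lemma pairingZ l (a : R[i]) x : pairing l (a *: x) = a * pairing l x.
Proof. by rewrite -[a *: x]addr0 pairing_is_linear pairing0 addr0. Qed.

Lemma pairingB l x y : pairing l (x - y) = pairing l x - pairing l y.
Proof. by rewrite addrC -scaleN1r pairing_is_linear mulN1r addrC. Qed.

Lemma complexify_mapZ (P : {linear V -> V}) (a : R[i]) x :
  complexify_map P (a *: x : complexification V) =
  a *: (complexify_map P x : complexification V).
Proof.
have := complexify_map_is_linear P a x 0.
have -> : complexify_map P (0 : complexification V) = (0 : complexification V).
  by rewrite /complexify_map /= linear0.
by rewrite !addr0.
Qed.

(** One [mu] moves every <l, x> into the first quadrant, so the real and imaginary parts of mu x are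
    nonnegative under the dual cone, and separation puts them in [C]. *)
Lemma canonical_complexification_rotation (C : set V) x :
  closed C -> convex_cone C -> C !=set0 -> canonical_complexification C x ->
  exists lam u v,
    [/\ lam != 0, C u, C v & x = lam *: ((u, v) : complexification V)].
Proof.
move=> C_closed C_cone C0 Cx.
have [|mu mu0 muZ] :=
    @acute_family_quadrant R [set pairing l x | l in dual_cone C].
  by move=> _ _ [l Cl <-] [l' Cl' <-]; exact: Cx.
exists mu^-1, (mu *: x).1, (mu *: x).2; split.
- by rewrite invr_eq0.
- apply: dual_cone_separation => // l Cl.
  have [+ _] := muZ (pairing l x) (ex_intro2 _ _ l Cl erefl).
  by rewrite -pairingZ.
- apply: dual_cone_separation => // l Cl.
  have [_ +] := muZ (pairing l x) (ex_intro2 _ _ l Cl erefl).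
  by rewrite -pairingZ.
- by rewrite -surjective_pairing scalerA mulVf// scale1r.
Qed.

End Complexification.

(** * Comparison of [A] with [P] on the complex cone *)

Section Perturbation.
Variables (R : realType) (V : normedModType R) (C : set V).
Hypotheses (C_closed : closed C) (C_cone : convex_cone C).
Hypothesis C_proper : proper_cone C.
Variables (P : {linear V -> V}).
Variables (A : {linear complexification V -> complexification V}).
Variables (Delta eps : R).
Hypothesis PC : P @` (C `\ 0) `<=` C `\ 0.
Hypothesis P_diam :
  (diameter (hilbert_metric C) (P @` (C `\ 0))%R <= Delta%:E)%E.
Hypothesis eps_gt0 : 0 < eps.
Hypothesis A_near_P : forall (m : {linear V -> R^o}) (u : V),
  dual_cone C m -> C u ->
  normc (pairing m (A (of_real u))
         - pairing m (complexify_map P (of_real u))) <= eps * m (P u).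

Let eta := 2 * eps * (1 + coshR (Delta / 2)).
Hypothesis eta_lt1 : eta < 1.

Let PE (x : complexification V) : complexification V := complexify_map P x.

Lemma map_cone u : C u -> u != 0 -> C (P u) /\ P u != 0.
Proof.
move=> Cu /eqP u0; have [] := PC (imageP P (conj Cu u0)).
by move=> CPu /eqP.
Qed.

Lemma map_cone0 u : C u -> C (P u).
Proof.
move=> Cu; have [u0|u0] := eqVneq u 0; last by have [] := map_cone Cu u0.
by rewrite u0 linear0 -u0.
Qed.

Lemma image_cross_le u v (l1 l2 : {linear V -> R^o}) :
  C u -> C v -> dual_cone C l1 -> dual_cone C l2 ->
  l1 (P v) * l2 (P u) <= expR Delta * (l1 (P u) * l2 (P v)).
Proof.
move=> Cu Cv Cl1 Cl2.
have [->|u0] := eqVneq u 0; first by rewrite !linear0 mulr0 mul0r mulr0.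
have [->|v0] := eqVneq v 0; first by rewrite !linear0 mul0r !mulr0.
have [CPu Pu0] := map_cone Cu u0; have [CPv Pv0] := map_cone Cv v0.
apply: (hilbert_metric_dual C_closed C_cone C_proper) => //.
apply: le_trans P_diam; apply: ereal_sup_ubound.
exists (P u); first by exists u => //; split=> //; exact/eqP.
by exists (P v) => //; exists v => //; split=> //; exact/eqP.
Qed.

(** Both sides scale by |lam|^2 under x -> lam x, which reduces [x] to u + iv with [u], [v] in [C],
    where [quadrant_error_le] applies. *)
Lemma pairing_perturbation_le x (l1 l2 : {linear V -> R^o}) :
  C !=set0 -> canonical_complexification C x ->
  dual_cone C l1 -> dual_cone C l2 ->
  let a1 := pairing l1 (PE x) in let a2 := pairing l2 (PE x) in
  let w1 := pairing l1 (A x) in let w2 := pairing l2 (A x) in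
  normc (w1 - a1) * normc a2 + normc (w2 - a2) * normc a1
    + normc (w1 - a1) * normc (w2 - a2) <= eta * complex.Re (a1 * a2^*%C).
Proof.
move=> C0 Cx Cl1 Cl2; cbv zeta.
have [lam [u [v [_ Cu Cv ->]]]] :=
  canonical_complexification_rotation C_closed C_cone C0 Cx.
set y : complexification V := (u, v).
have AyE : A y = A (of_real u) + 'i *: A (of_real v).
  rewrite -linearZ -linearD; congr (A _); congr (_, _).
    by rewrite /= scale0r scaler0 subr0 addr0.
  by rewrite /= scale1r scaler0 addr0 add0r.
have errE (l : {linear V -> R^o}) : pairing l (A y) - pairing l (PE y) =
    (pairing l (A (of_real u)) - pairing l (PE (of_real u))) +
    'i * (pairing l (A (of_real v)) - pairing l (PE (of_real v))).
  rewrite AyE [A _ + _]addrC pairing_is_linear /PE /pairing /= !linear0.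
  case: (A _) => [x1 y1]; case: (A _) => [x2 y2] /=.
  by congr (_ +i* _) => /=; ring.
(* [A_near_P] concerns real vectors, so it is applied to [u] and [v] separately; the errors add
   since |i| = 1. *)
have err (l : {linear V -> R^o}) : dual_cone C l ->
    0 <= normc (pairing l (A y) - pairing l (PE y))
      <= eps * (l (P u) + l (P v)).
  move=> Cl; rewrite normc_ge0 errE; apply: le_trans (normc_le_add _ _) _.
  have i1 : normc ('i : R[i]) = 1 by rewrite /= expr0n expr1n add0r sqrtr1.
  rewrite normcM i1 mul1r.
  by rewrite mulrDr; apply: lerD; exact: A_near_P.
have scale (l : {linear V -> R^o}) :
    pairing l (A (lam *: y)) = lam * pairing l (A y) /\
    pairing l (PE (lam *: y)) = lam * pairing l (PE y).
  by rewrite linearZ /PE complexify_mapZ !pairingZ.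
have [-> ->] := scale l1; have [-> ->] := scale l2.
have pos (l : {linear V -> R^o}) w : dual_cone C l -> C w -> 0 <= l (P w).
  by move=> Cl Cw; apply: Cl.2; exact: map_cone0.
have k0 := expR_gt0 (Delta / 2).
have kE : expR (Delta / 2) ^+ 2 = expR Delta.
  by rewrite -expRM_natl; congr expR; lra.
have := @quadrant_error_le R eps (expR (Delta / 2)) (coshR (Delta / 2))
  (l1 (P u)) (l1 (P v)) (l2 (P u)) (l2 (P v))
  (normc (pairing l1 (PE y))) (normc (pairing l2 (PE y)))
  (normc (pairing l1 (A y) - pairing l1 (PE y)))
  (normc (pairing l2 (A y) - pairing l2 (PE y))) k0 (coshR_ge1 _).
rewrite kE => /(_ _ eps_gt0 (ltW eta_lt1) (pos _ _ Cl1 Cu) (pos _ _ Cl1 Cv)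
  (pos _ _ Cl2 Cu) (pos _ _ Cl2 Cv) (normc_ge0 _) (normc_ge0 _)
  (normc_sqr _) (normc_sqr _) _ _ (err _ Cl1) (err _ Cl2)).
have -> : expR Delta + 1 = 2 * coshR (Delta / 2) * expR (Delta / 2).
  rewrite /coshR expRN -kE; have := gt_eqF k0.
  by move: (expR _) => k kn; field; rewrite kn.
move=> /(_ erefl); rewrite [l2 (P u) * _]mulrC -[l1 (P v) * l2 (P u)]mulrC.
have h1 := image_cross_le Cu Cv Cl1 Cl2.
have h2 := image_cross_le Cv Cu Cl1 Cl2.
rewrite [l2 (P u) * _]mulrC.
move=> /(_ h2 h1) main.
rewrite -!mulrBr !normcM.
have -> : complex.Re (lam * pairing l1 (PE y) * (lam * pairing l2 (PE y))^*%C) =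
    normc lam ^+ 2 * (l1 (P u) * l2 (P u) + l1 (P v) * l2 (P v)).
  by rewrite normc_sqr; case: (lam) => r s; rewrite /pairing/=; ring.
have := ler_wpM2l (sqr_ge0 (normc lam)) main; rewrite /eta; lra.
Qed.

(** One of [u], [v] is nonzero, hence so is its image in [C]; a functional positive there gives a
    nonzero real or imaginary part. *)
Lemma canonical_complexification_pairing_neq0 x :
  C !=set0 -> canonical_complexification C x -> x != 0 ->
  exists2 l : {linear V -> R^o}, dual_cone C l & pairing l (PE x) != 0.
Proof.
move=> C0 Cx x0.
have [lam [u [v [lam0 Cu Cv xE]]]] :=
  canonical_complexification_rotation C_closed C_cone C0 Cx.
have nz w : C w -> w != 0 ->
    exists2 l : {linear V -> R^o}, dual_cone C l & 0 < l (P w).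
  by move=> Cw w0; have [CPw Pw0] := map_cone Cw w0; exact: dual_cone_pos.
have : (u != 0) || (v != 0).
  rewrite -negb_and; apply: contra x0 => /andP[/eqP u0 /eqP v0].
  by rewrite xE u0 v0 scaler0.
rewrite xE /PE complexify_mapZ.
move=> /orP[/(nz _ Cu)|/(nz _ Cv)] [l Cl lw]; exists l => //;
  by rewrite pairingZ mulf_neq0// eq_complex/= (gt_eqF lw) ?andbF.
Qed.

Lemma eta_gt0 : 0 < eta.
Proof.
by have := coshR_ge1 (Delta / 2) => c1; rewrite /eta !mulr_gt0//; lra.
Qed.

Lemma image_canonical_complexification x : C !=set0 ->
  canonical_complexification C x -> x != 0 ->
  canonical_complexification C (A x) /\ A x != 0.
Proof.
move=> C0 Cx x0.
have W l1 l2 (Cl1 : dual_cone C l1) (Cl2 : dual_cone C l2) :=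
  Re_mul_conj_ge (pairing_perturbation_le C0 Cx Cl1 Cl2).
(* The estimate bounds eta times this real part below by a sum of products of moduli. *)
have D l1 l2 (Cl1 : dual_cone C l1) (Cl2 : dual_cone C l2) :
    0 <= complex.Re (pairing l1 (PE x) * (pairing l2 (PE x))^*%C).
  rewrite -(pmulr_rge0 _ eta_gt0).
  apply: le_trans (pairing_perturbation_le C0 Cx Cl1 Cl2).
  by rewrite !addr_ge0// mulr_ge0// normc_ge0.
have eta1 : 0 < 1 - eta by rewrite subr_gt0.
split=> [l1 l2 Cl1 Cl2|].
  by apply: le_trans (W _ _ Cl1 Cl2); rewrite mulr_ge0// ?D// ltW.
have [l Cl lx] := canonical_complexification_pairing_neq0 C0 Cx x0.
apply/eqP => Ax0.
have := lt_le_trans (mulr_gt0 eta1 (Re_mul_conj_gt0 lx)) (W _ _ Cl Cl).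
by rewrite Ax0 pairing0 mul0r ltxx.
Qed.

Lemma projective_metric_perturbation_le x : C !=set0 ->
  canonical_complexification C x -> x != 0 ->
  (projective_metric (canonical_complexification C `\ 0)%R (A x) (PE x) <=
   (3 * ln (1 / (1 - eta)))%:E)%E.
Proof.
move=> C0 Cx x0; have eta0 := eta_gt0.
have e1 : 0 < 1 - eta by rewrite subr_gt0.
have E z : exceptional_set (canonical_complexification C `\ 0) (A x) (PE x) z ->
    (1 + eta)^-1 <= normc z <= (1 + eta) / (1 - eta).
  move=> zE; have eta01 : 0 < eta < 1 by rewrite eta0.
  suff [l1 [l2 [Cl1 Cl2]]] : exists l1 l2 : {linear V -> R^o},
      [/\ dual_cone C l1, dual_cone C l2 &
      let a1 := pairing l1 (PE x) in let a2 := pairing l2 (PE x) in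
      let w1 := pairing l1 (A x) in let w2 := pairing l2 (A x) in
      let q := complex.Re ((z * w1 - a1) * (z * w2 - a2)^*%C) in
      q < 0 \/ q <= 0 /\ 0 < complex.Re (a1 * a2^*%C)].
    have := pairing_perturbation_le C0 Cx Cl1 Cl2.
    exact: exceptional_norm_bounds eta01.
  (* If z A x = P x, the real part vanishes and l1 = l2 = l makes the one for P x positive;
     otherwise a strictly negative real part exists. *)
  have [z0|z0] := eqVneq (z *: A x) (PE x).
    have [l Cl lx] := canonical_complexification_pairing_neq0 C0 Cx x0.
    exists l, l; split=> //; right; rewrite -pairingZ z0 subrr mul0r.
    by split=> //; exact: Re_mul_conj_gt0.
  have : ~ canonical_complexification C (z *: A x - PE x).
    by move=> Cz; apply: zE; split=> //; apply/eqP; rewrite subr_eq0.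
  move=> /existsNP[l1 /existsNP[l2 /not_implyP[Cl1 /not_implyP[Cl2 /negP]]]].
  rewrite -ltNge !pairingB !pairingZ => q0.
  by exists l1, l2; split=> //; left.
have e2 : 0 < 1 + eta by rewrite addr_gt0.
have lo0 : 0 < (1 + eta)^-1 by rewrite invr_gt0.
have lohi : (1 + eta)^-1 <= (1 + eta) / (1 - eta).
  rewrite -div1r ler_pdivrMr// mulrAC ler_pdivlMr//.
  by have := mulr_ge0 (ltW eta0) (ltW eta0); lra.
apply: (@le_trans _ _ (ln ((1 + eta) / (1 - eta) / (1 + eta)^-1))%:E).
  apply: log_ratio_le => // _ [z /E zE <-].
  by rewrite !lee_fin.
rewrite lee_fin mulr_natl -lnXn ?divr_gt0//.
rewrite ler_ln ?posrE ?exprn_gt0 ?divr_gt0//.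
rewrite invrK expr_div_n expr1n ler_pdivlMr ?exprn_gt0//.
(* The ratio of the bounds on |z| is (1 + eta)^2 / (1 - eta); comparing it with (1 - eta)^-3 amounts
   to (1 - eta^2)^2 <= 1. *)
have -> : (1 + eta) / (1 - eta) * (1 + eta) * (1 - eta) ^+ 3 =
    (1 - eta ^+ 2) ^+ 2.
  by field; rewrite gt_eqF.
rewrite expr_le1//; first by rewrite gerBl sqr_ge0.
by have := ltr_pM (ltW eta0) (ltW eta0) eta_lt1 eta_lt1; lra.
Qed.

End Perturbation.

(** * Invariance of the complex cone and the uniform distance bound *)

Theorem theorem4p5 (R : realType) (V : completeNormedModType R) (CR : set V)
  (CR_closed : closed CR)
  (CR_cone : convex_cone CR)
  (CR_proper : proper_cone CR)
  (CR_dim2 : exists x y : V, [/\ CR x, CR y & lin_indep2 x y])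
  (P : {linear V -> V})
  (P_CR : P @` (CR `\ 0) `<=` CR `\ 0)
  (A : {linear complexification V -> complexification V})
  (DeltaP : R)
  (diam_P : diameter (hilbert_metric CR) (P @` (CR `\ 0)) = DeltaP%:E)
  (eps : R) (eps_gt0 : 0 < eps)
  (A_near_P : forall (m : {linear V -> R^o}) (u : V), dual_cone CR m -> CR u ->
     normc (pairing m (A (of_real u))
            - pairing m (complexify_map P (of_real u))) <= eps * m (P u))
  (eps_small : 2 * eps * (1 + coshR (DeltaP / 2)) < 1) :
  let C : set (complexification V) := canonical_complexification CR `\ 0 in
  A @` C `<=` C /\
  (ereal_sup [set projective_metric C (A x) (complexify_map P x) | x in C] <=
   (3 * ln (1 / (1 - 2 * eps * (1 + coshR (DeltaP / 2)))))%:E)%E.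
Proof.
move=> C.
have CR0 : CR !=set0 by have [x [y [CRx _ _]]] := CR_dim2; exists x.
have P_diam : (diameter (hilbert_metric CR) (P @` (CR `\ 0))%R <= DeltaP%:E)%E.
  by rewrite diam_P.
split.
  move=> _ [x [Cx /eqP x0] <-].
  have [CAx /eqP Ax0] := image_canonical_complexification CR_closed CR_cone
    CR_proper P_CR P_diam eps_gt0 A_near_P eps_small CR0 Cx x0.
  by split.
apply: ge_ereal_sup => _ [x [Cx /eqP x0] <-].
exact: (projective_metric_perturbation_le CR_closed CR_cone CR_proper
  P_CR P_diam eps_gt0 A_near_P eps_small CR0 Cx x0).
Qed.
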